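(* Let $a\ge1$ be an integer and $n=2a+1$. The Specht ideal $I_{(a,a,1)}^{\mathrm{Sp}}\subset R$ is a radical ideal.
   Context: Let $K$ be a field, $[n]=\{1,\ldots,n\}$, and $R=K[x_1,\ldots,x_n]$. For a partition $\lambda=(\lambda_1\ge\cdots\ge\lambda_l\ge1)$ of $n$, a tableau of shape $\lambda$ is a bijection from $[n]$ to the set of boxes of the (left-justified) Young diagram of $\lambda$, which has $\lambda_i$ boxes in row $i$. For a tableau $T$ of shape $\lambda$, if the $j$-th column of $T$ consists of $j_1,\ldots,j_m$ from top to bottom, set $f_T(j)=\prod_{1\le s<t\le m}(x_{j_s}-x_{j_t})$ (equal to $1$ if $m=1$), and let the Specht polynomial of $T$ be $f_T=\prod_{j=1}^{\lambda_1}f_T(j)$. The Specht ideal is $I_\lambda^{\mathrm{Sp}}=(f_T\mid T\text{ a tableau of shape }\lambda)\subset R$. *)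

(* Defs.v *)
From mathcomp Require Import all_boot all_order all_algebra.
From mathcomp.multinomials Require Import mpoly.

Set Implicit Arguments.
Unset Strict Implicit.
Unset Printing Implicit Defensive.

Import GRing.Theory.

Local Open Scope ring_scope.

Section Tableaux.

Variable la : seq nat.

(* Rows and columns are numbered from 0: row i has nth 0 la i boxes.
   The definitions below make sense for any list la and are meant for
   partitions (weakly decreasing lists of positive integers). *)
Definition box : Type := {i : 'I_(size la) & 'I_(nth 0%N la i)}.

Definition row_of (b : box) : nat := tag b.
Definition col_of (b : box) : nat := tagged b.

Variable n : nat.

(* A bijection from the n indices to the boxes exists only if sumn la = n. *)
Record tableau := Tableau {
  entry_box :> 'I_n -> box;
  entry_box_bij : bijective entry_box }.

Variable K : fieldType.

(* The pairs s < t of positions in column j, read from top to bottom, are the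
   pairs of entries (p, q) of column j with p in a higher row than q. *)
Definition specht_col (T : tableau) (j : nat) : {mpoly K[n]} :=
  \prod_(p < n | col_of (T p) == j)
    \prod_(q < n | (col_of (T q) == j) && (row_of (T p) < row_of (T q))%N)
      ('X_p - 'X_q).

Definition specht_poly (T : tableau) : {mpoly K[n]} :=
  \prod_(0 <= j < head 0%N la) specht_col T j.

End Tableaux.

Section Ideals.

Variable R : comNzRingType.

Definition is_ideal (I : R -> Prop) : Prop :=
  [/\ I 0,
      forall p q, I p -> I q -> I (p + q)
    & forall c p, I p -> I (c * p)].

Definition ideal_gen (G : R -> Prop) (p : R) : Prop :=
  exists2 s : seq (R * R),
    (forall u, u \in s -> G u.2) & p = \sum_(u <- s) u.1 * u.2.

Definition is_radical_ideal (I : R -> Prop) : Prop :=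
  is_ideal I /\ (forall (p : R) (k : nat), I (p ^+ k) -> I p).

End Ideals.

Definition specht_ideal (K : fieldType) (n : nat) (la : seq nat) :
    {mpoly K[n]} -> Prop :=
  ideal_gen (fun f => exists T : tableau la n, f = specht_poly K T).
Arguments specht_ideal K n la : clear implicits.

(* Main.v *)
Require Import Defs.
From HB Require Import structures.
From mathcomp Require Import all_boot all_order all_algebra all_fingroup.
From mathcomp.multinomials Require Import mpoly.
From mathcomp Require Import zify ring.

Set Implicit Arguments.
Unset Strict Implicit.
Unset Printing Implicit Defensive.

Import GRing.Theory.

Local Open Scope ring_scope.

(** The zero set of the Specht ideal of (a, a, 1), over any extension of K, is
    the set of points at which some value occurs more than a times.  If f ^+ k
    lies in the ideal, then f vanishes at all these points, with coordinates in
    the infinite domain K[t].  So it suffices that a polynomial f vanishing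
    there belongs to the ideal; this takes two steps.

    First step ([vanish_mem]).  More generally, let D be a set of points that is
    stable in the following sense.  A word r, read as the list of rows to which
    the boxes 0, 1, 2, ... are added, is a filling with increasing rows; the
    column of box i is the number [occ r i] of earlier boxes in its row.  D is
    [column_closed] if, for r in D, it contains every point whose coordinates
    are distinct within each column of r.  Then the products of Vandermonde
    polynomials of the columns of r, for r in D, generate the ideal of all
    polynomials vanishing off D.  This goes by induction on the number of
    variables and on the degree d in the last one.  Consider the set of the r
    that become members of D after adding one box, in a row v such that the
    column of the new box has at most d other boxes ([add_box]).  It is again
    column-closed, and the leading coefficient of f vanishes off it: if p is
    not in it, then f (p, v) = 0 for at least d + 1 values v.  By induction the
    leading coefficient is a combination of column products for this set.
    Adding a box turns each of them into a column product for D which, times a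
    power of the last variable, has degree d in it and that leading coefficient
    up to sign.  Both properties of [add_box] rest on one counting fact,
    [exists_frequent_value].

    Second step ([colprod_balance]).  For D the points all of whose values occur
    at most a times, the fillings obtained have at most a columns, but of
    arbitrary lengths.  Lagrange interpolation at the variables of a column A
    writes the product of the Vandermonde polynomials of A and of a shorter
    column B as a combination of those obtained by moving one element from A to
    B.  Repeating this makes the lengths differ by at most one.  Since there
    are 2 a + 1 variables, they are then 3, 2, ..., 2, and the product is a
    Specht polynomial of shape (a, a, 1). *)

(** * Ideals generated by a set *)

Section IdealGen.

Variables (R : comNzRingType) (G : R -> Prop).

Lemma ideal_gen_ideal : is_ideal (ideal_gen G).
Proof.
split=> [|p q [s hs ->] [t ht ->]|c p [s hs ->]].
- by exists [::]; rewrite ?big_nil.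
- exists (s ++ t); last by rewrite big_cat.
  by move=> u; rewrite mem_cat => /orP[/hs|/ht].
- exists [seq (c * u.1, u.2) | u <- s].
    by move=> _ /mapP[u us ->]; apply: (hs u us).
  by rewrite big_map mulr_sumr; apply: eq_bigr => u _; rewrite mulrA.
Qed.

Lemma mem_ideal_gen g : G g -> ideal_gen G g.
Proof.
move=> Gg; exists [:: (1, g)]; last by rewrite big_seq1 mul1r.
by move=> u; rewrite inE => /eqP->.
Qed.

Lemma is_ideal_sum (I : R -> Prop) (T : Type) (r : seq T) (P : pred T) F :
  is_ideal I -> (forall i, P i -> I (F i)) -> I (\sum_(i <- r | P i) F i).
Proof. by case=> I0 ID _ IF; apply: (big_ind I). Qed.

Lemma ideal_gen_min (I : R -> Prop) p :
  is_ideal I -> (forall g, G g -> I g) -> ideal_gen G p -> I p.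
Proof.
move=> idI GI [s hs ->]; rewrite big_seq; apply: is_ideal_sum => // u us.
by case: idI => _ _ IM; apply/IM/GI/hs.
Qed.

End IdealGen.

(** * Polynomials in the last variable *)

Section LastVariable.

Variables (n : nat) (K : comNzRingType).

Lemma eq_mpoly_rmorph k (S : comNzRingType)
    (f g : {rmorphism {mpoly K[k]} -> S}) :
  (forall c, f c%:MP = g c%:MP) -> (forall i, f 'X_i = g 'X_i) -> f =1 g.
Proof.
move=> eqC eqX; elim/mpolyind=> [|c m p _ _ IHp]; first by rewrite !rmorph0.
rewrite !rmorphD IHp -mul_mpolyC !rmorphM eqC mpolyXE_id !rmorph_prod.
by congr (_ * _ + _); apply: eq_bigr => i _; rewrite !rmorphXn eqX.
Qed.

Lemma muni_widen (i : 'I_n) :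
  muni ('X_(widen_ord (leqnSn n) i) : {mpoly K[n.+1]}) = ('X_i)%:P.
Proof.
rewrite /muni mmapX mmap1U; case: splitP => [j eq_ij|j].
  by congr ('X__)%:P; apply/val_inj; rewrite /= -eq_ij.
by rewrite ord1 /= addn0 => /eqP; rewrite ltn_eqF.
Qed.

Lemma muni_max : muni ('X_ord_max : {mpoly K[n.+1]}) = 'X.
Proof.
rewrite /muni mmapX mmap1U; case: splitP => // j /= /eqP.
by rewrite eq_sym ltn_eqF.
Qed.

Lemma mwidenU (i : 'I_n) :
  mwiden ('X_i : {mpoly K[n]}) = 'X_(widen_ord (leqnSn n) i).
Proof. by rewrite /mwiden mmapX mmap1U. Qed.

Lemma muni_mwiden (g : {mpoly K[n]}) : muni (mwiden g) = g%:P.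
Proof.
apply: (@eq_mpoly_rmorph _ _ (@muni n K \o @mwiden n K) polyC) => [c|i] /=.
  by rewrite mwidenC muniC.
by rewrite mwidenU muni_widen.
Qed.

(** With S the polynomial ring itself and h its variables, this recovers f from
    [muni f]; with values h i in a domain, it evaluates f at all coordinates but
    the last, and then at the last. *)
Lemma horner_muni (S : comNzRingType) (phi : {rmorphism K -> S})
    (h : 'I_n.+1 -> S) (f : {mpoly K[n.+1]}) :
  (map_poly (mmap phi (h \o widen_ord (leqnSn n))) (muni f)).[h ord_max] =
  mmap phi h f.
Proof.
pose psi := mmap phi (h \o widen_ord (leqnSn n)).
pose ev := horner_eval (h ord_max) \o (map_poly psi \o @muni n K).
have evE g : ev g = (map_poly psi (muni g)).[h ord_max] by [].
rewrite -/psi -evE.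
apply: (@eq_mpoly_rmorph _ _ ev (mmap phi h)) => [c|i];
  rewrite -[LHS]/(ev _) evE.
  by rewrite muniC map_polyC hornerC /psi /= !mmapC.
rewrite [RHS]mmapX mmap1U.
have [j ->|->] := unliftP ord_max i; last by rewrite muni_max map_polyX hornerX.
have -> : lift ord_max j = widen_ord (leqnSn n) j.
  by apply/val_inj; rewrite /= /bump leqNgt ltn_ord.
by rewrite muni_widen map_polyC hornerC /psi /= mmapX mmap1U.
Qed.

Lemma muni_inj : injective (@muni n K).
Proof.
apply: raddf_inj => f f0.
have := horner_muni (@mpolyC n.+1 K) (fun i => 'X_i) f.
rewrite f0 map_poly0 horner0 => /esym <-; apply/esym.
pose recover := mmap (@mpolyC n.+1 K) (fun i => 'X_i).
apply: (@eq_mpoly_rmorph _ _ recover idfun) => [c|i] /=; rewrite /recover.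
  by rewrite mmapC.
by rewrite mmapX mmap1U.
Qed.

End LastVariable.

(** * Words, multiplicities and columns *)

Section Multiplicity.

Variables (L : eqType) (fresh : forall s : seq L, exists v, v \notin s).
Implicit Types (p r : nat -> L) (v : L) (n i j : nat).

Definition mult n p v : nat := (\sum_(i < n) (p i == v))%N.

(** The column of box i, when r i is the row to which the i-th box is added. *)
Definition occ p i : nat := mult i p (p i).

Definition ext p n v : nat -> L := fun i => if (i < n)%N then p i else v.

Lemma sum_pred_size n (a : pred nat) :
  (\sum_(i < n) a i)%N = size [seq i <- iota 0 n | a i].
Proof.
rewrite size_filter -sum1_count [RHS]big_mkcond -[n in RHS]subn0.
by rewrite -/(index_iota 0 n) big_mkord; apply: eq_bigr => i _; case: (a i).
Qed.

Lemma eq_mult n p r v :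
  (forall i, (i < n)%N -> p i = r i) -> mult n p v = mult n r v.
Proof. by move=> eq_pr; apply: eq_bigr => i _; rewrite eq_pr. Qed.

Lemma occ_ext p n v i : (i < n)%N -> occ (ext p n v) i = occ p i.
Proof.
move=> ltin; rewrite /occ {2}/ext ltin; apply: eq_mult => j ltji.
by rewrite /ext (ltn_trans ltji ltin).
Qed.

Lemma occ_ext_last p n v : occ (ext p n v) n = mult n p v.
Proof.
rewrite /occ {2}/ext ltnn; apply: eq_mult => j ltjn.
by rewrite /ext ltjn.
Qed.

Lemma multS n p v : mult n.+1 p v = (mult n p v + (p n == v))%N.
Proof. by rewrite /mult big_ord_recr. Qed.

Lemma leq_mult n m p v : (n <= m)%N -> (mult n p v <= mult m p v)%N.
Proof.
elim: m => [|m IHm]; first by rewrite leqn0 => /eqP->.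
rewrite leq_eqVlt => /predU1P[->//|]; rewrite ltnS multS => /IHm le_nm.
exact: leq_trans le_nm (leq_addr _ _).
Qed.

Lemma occ_lt_mult p n i : (i < n)%N -> (occ p i < mult n p (p i))%N.
Proof.
move=> ltin; apply: leq_trans (leq_mult p (p i) ltin).
by rewrite multS eqxx addn1.
Qed.

Lemma mult_le n p v : (mult n p v <= n)%N.
Proof.
rewrite -[n in (_ <= n)%N]card_ord -sum1_card; apply: leq_sum => i _.
exact: leq_b1.
Qed.

Lemma occ_inj p i j : p i = p j -> occ p i = occ p j -> i = j.
Proof.
move=> eqp eqo; case: (ltngtP i j) => // /(occ_lt_mult p).
  by rewrite eqo eqp ltnn.
by rewrite -eqo -eqp ltnn.
Qed.

(** Take v of largest multiplicity among the values outside s.  If i is counted,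
    then p i occurs strictly more often than v, so it belongs to s; and i is
    determined by p i together with its occurrence number. *)
Lemma exists_frequent_value p n (s : seq L) :
  exists2 v, v \notin s &
    (\sum_(i < n) (occ p i == mult n p v) <= size s)%N.
Proof.
have [w ws] := fresh s.
(* The value w may be absent from p; it ensures that there is a candidate. *)
pose P m := has (fun v => (v \notin s) && (mult n p v == m)) (w :: mkseq p n).
have exP : exists m, P m.
  by exists (mult n p w); rewrite /P /= ws eqxx.
have ubP m : P m -> (m <= n)%N.
  by case/hasP => v _ /andP[_ /eqP <-]; apply: mult_le.
case: (ex_maxnP exP ubP) => m /hasP[v _ /andP[vs /eqP <-]] max_v.
exists v => //.
pose t := [seq i <- iota 0 n | occ p i == mult n p v].
have -> : (\sum_(i < n) (occ p i == mult n p v))%N = size (map p t).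
  by rewrite size_map -sum_pred_size.
apply: uniq_leq_size.
  rewrite map_inj_in_uniq ?filter_uniq ?iota_uniq // => i j.
  rewrite !mem_filter => /andP[/eqP oi _] /andP[/eqP oj _] eqp.
  by apply: occ_inj eqp _; rewrite oi oj.
move=> _ /mapP[i + ->]; rewrite mem_filter mem_iota add0n.
move=> /andP[/eqP oi /= ltin]; apply: contraLR (occ_lt_mult p ltin) => pis.
rewrite -leqNgt oi; apply/max_v/hasP; exists (p i); last by rewrite pis eqxx.
by rewrite inE map_f ?orbT // mem_iota.
Qed.

(** Bounding the partition of multiplicities from above in dominance order gives
    such a set, by the easy half of the Gale-Ryser theorem: columns without
    repetition exist only if the content is dominated by the shape. *)
Definition column_closed n (D : (nat -> L) -> Prop) : Prop :=
  forall r p, D r ->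
    (forall i j, (i < j < n)%N -> occ r i = occ r j -> p i != p j) -> D p.

(** The sum counts the boxes in the column to which a box added to row v goes,
    that is, the degree in the new variable that this box contributes. *)
Definition add_box n (D : (nat -> L) -> Prop) d r : Prop :=
  exists2 v, (\sum_(i < n) (occ r i == mult n r v) <= d)%N & D (ext r n v).

(** Let p be injective on the columns of r, and let the new box of r go to the
    column with entries s.  Extending p by a frequent value outside the values
    of p on s keeps it injective on columns, so the extension belongs to D. *)
Lemma column_closed_add_box n D d :
  column_closed n.+1 D -> column_closed n (add_box n D d).
Proof.
move=> clD r p [v le_d Dr] inj_p.
pose s := [seq p i | i <- iota 0 n & occ r i == mult n r v].
have [u us le_u] := exists_frequent_value p n s.
exists u.
  apply: leq_trans le_u _; apply: leq_trans le_d.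
  by rewrite size_map -sum_pred_size.
apply: clD Dr _ => i j /andP[ltij]; rewrite ltnS leq_eqVlt => /predU1P[eqj|ltjn].
  rewrite eqj occ_ext_last occ_ext -?eqj // eqj => oi.
  rewrite /ext -eqj ltij ltnn; apply: contraNneq us => <-.
  by apply/map_f; rewrite mem_filter oi eqxx mem_iota /= -eqj.
have ltin := ltn_trans ltij ltjn.
by rewrite !occ_ext // /ext ltin ltjn => /inj_p; apply; rewrite ltij.
Qed.

End Multiplicity.

(** * Products of Vandermonde polynomials of columns *)

Section ColumnVandermonde.

Variables (K : comNzRingType) (C : eqType).

Definition colvdm n (c : nat -> C) : {mpoly K[n]} :=
  \prod_(p < n) \prod_(q < n | (c p == c q) && (p < q)%N) ('X_p - 'X_q).

Lemma eq_colvdm n (c c' : nat -> C) :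
  (forall i, (i < n)%N -> c i = c' i) -> colvdm n c = colvdm n c'.
Proof.
move=> eqc; apply: eq_bigr => i _; apply: eq_bigl => j.
by rewrite !eqc.
Qed.

Lemma muni_colvdmS n (c : nat -> C) :
  muni (colvdm n.+1 c) =
  (colvdm n c)%:P * \prod_(p < n | c p == c n) (('X_p)%:P - 'X).
Proof.
rewrite /colvdm big_ord_recr /= [X in _ * X]big1 ?mulr1 => [|q /andP[_ ltnq]].
  rewrite !rmorph_prod [X in _ * X]big_mkcond -big_split /=.
  apply: eq_bigr => i _; rewrite big_mkcond big_ord_recr /= -big_mkcond /=.
  rewrite rmorphM rmorph_prod ltn_ord andbT; congr (_ * _).
    rewrite rmorph_prod; apply: eq_bigr => j _.
    by rewrite rmorphB /= !muni_widen -polyCB.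
  case: ifP => _; last exact: rmorph1.
  by rewrite rmorphB /= muni_widen muni_max.
by have := ltn_ord q; rewrite ltnS leqNgt ltnq.
Qed.

End ColumnVandermonde.

Lemma size_subr_lead (R : nzRingType) (P Q : {poly R}) d :
  (size P <= d.+1)%N -> (size Q <= d.+1)%N -> P`_d = Q`_d ->
  (size (P - Q)%R <= d)%N.
Proof.
move=> szP szQ eqd; apply/leq_sizeP => j.
rewrite leq_eqVlt coefB => /predU1P[<-|ltdj]; first by rewrite eqd subrr.
by rewrite !nth_default ?subrr // (leq_trans _ ltdj).
Qed.

(** * Polynomials vanishing off a column-closed set *)

Section Vanishing.

Variables (K : fieldType) (L : idomainType) (phi : {rmorphism K -> L}).
Hypothesis fresh : forall s : seq L, exists v, v \notin s.

Definition ev n (p : nat -> L) : {mpoly K[n]} -> L :=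
  mmap phi (fun i : 'I_n => p i).

HB.instance Definition _ n p :=
  GRing.RMorphism.copy (@ev n p) (mmap phi (fun i : 'I_n => p i)).

Lemma evX n p (i : 'I_n) : ev p 'X_i = p i.
Proof. by rewrite /ev mmapX mmap1U. Qed.

Lemma horner_muni_ext n p v f :
  (map_poly (@ev n p) (muni f)).[v] = ev (ext p n v) f.
Proof.
rewrite /ev -horner_muni {2}/ext ltnn; congr (_.[_]).
apply: eq_map_poly => g; rewrite /mmap; apply: eq_bigr => m _.
by congr (_ * _); apply: mmap1_eq => i; rewrite /ext /= ltn_ord.
Qed.

(** A disjunction rather than an implication from [~ D p]: it lets the induction
    run without deciding [add_box], which quantifies over an infinite set. *)
Definition vanish n (D : (nat -> L) -> Prop) (f : {mpoly K[n]}) : Prop :=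
  forall p, D p \/ ev p f = 0.

Definition tableau_gen n (D : (nat -> L) -> Prop) (f : {mpoly K[n]}) : Prop :=
  exists2 r, D r & f = colvdm K n (occ r).

Lemma ev_colvdm_eq0 (C : eqType) n (c : nat -> C) (p : nat -> L) (i j : 'I_n) :
  (i < j)%N -> c i = c j -> p i = p j -> ev p (colvdm K n c) = 0.
Proof.
move=> ltij eqc eqp; rewrite /colvdm (bigD1 i) //= (bigD1 j) /= ?eqc ?eqxx //.
by rewrite !rmorphM rmorphB /= !evX eqp subrr !mul0r.
Qed.

Lemma ev_eq0_ideal n p : is_ideal (fun f => @ev n p f = 0).
Proof.
split=> [|f g f0 g0|h f f0]; first exact: rmorph0.
  by rewrite rmorphD /= f0 g0 addr0.
by rewrite rmorphM /= f0 mulr0.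
Qed.

Lemma vanish_ideal n D : is_ideal (@vanish n D).
Proof.
split=> [p|f g Vf Vg p|h f Vf p]; have [ev0 evD evM] := ev_eq0_ideal n p.
- by right.
- have [|f0] := Vf p; first by left.
  by have [|g0] := Vg p; [left|right; apply: evD].
- by have [|f0] := Vf p; [left|right; apply: evM].
Qed.

Lemma vanish_tableau_gen n D f :
  column_closed n D -> tableau_gen D f -> @vanish n D f.
Proof.
move=> clD [r Dr ->] p.
pose bad := [exists i : 'I_n, exists j : 'I_n,
  [&& (i < j)%N, occ r i == occ r j & p i == p j]].
have [/existsP[i /existsP[j /and3P[ltij /eqP eqo /eqP eqp]]]|good] := boolP bad.
  by right; apply: ev_colvdm_eq0 ltij eqo eqp.
left; apply: clD Dr _ => i j /andP[ltij ltjn] eqo.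
apply: contra good => eqp; apply/existsP; exists (Ordinal (ltn_trans ltij ltjn)).
by apply/existsP; exists (Ordinal ltjn); rewrite /= ltij eqo eqxx.
Qed.

(** Either p belongs to [add_box n D d], or [exists_frequent_value] provides
    d + 1 distinct roots of f (p, -), which has degree at most d. *)
Lemma vanish_coef n D d (f : {mpoly K[n.+1]}) :
  @vanish n.+1 D f -> (size (muni f) <= d.+1)%N ->
  @vanish n (add_box n D d) (muni f)`_d.
Proof.
move=> Vf sz p; pose P := map_poly (@ev n p) (muni f).
have szP : (size P <= d.+1)%N by apply: leq_trans (size_poly _ _) sz.
have step k : (k <= d.+1)%N -> add_box n D d p \/
    exists s, [/\ uniq s, size s = k & all (root P) s].
  elim: k => [|k IHk] lek; first by right; exists [::].
  have [|[s [us ss rs]]] := IHk (ltnW lek); first by left.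
  have [v vs le_v] := exists_frequent_value fresh p n s.
  have [Dv|f0] := Vf (ext p n v).
    by left; exists v => //; apply: leq_trans le_v _; rewrite ss -ltnS.
  right; exists (v :: s); rewrite /= vs us ss rs rootE /P horner_muni_ext f0.
  by rewrite eqxx.
have [|[s [us ss rs]]] := step d.+1 (leqnn _); first by left.
right; have P0 : P = 0 by apply: roots_geq_poly_eq0 rs us _; rewrite ss.
by rewrite -coef_map -/P P0 coef0.
Qed.

(** The box added to r contributes e <= d linear factors x_i - x_n.  Multiplying
    by a power of x_n makes the degree in x_n equal to d without changing the
    leading coefficient, which is the column product of r up to sign. *)
Lemma lead_tableau_gen n D d (g : {mpoly K[n]}) :
  ideal_gen (tableau_gen (add_box n D d)) g ->
  exists F : {mpoly K[n.+1]}, [/\ ideal_gen (tableau_gen D) F,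
    (size (muni F) <= d.+1)%N & (muni F)`_d = g].
Proof.
have [I0 ID IM] := ideal_gen_ideal (@tableau_gen n.+1 D).
(* The coefficients of degree d of such F form an ideal, so g may be taken to be
   a generator. *)
pose leads h := exists F : {mpoly K[n.+1]}, [/\ ideal_gen (tableau_gen D) F,
  (size (muni F) <= d.+1)%N & (muni F)`_d = h].
apply: (ideal_gen_min (I := leads)).
  split=> [|g1 g2|h g1].
  - by exists 0; rewrite muni0 size_poly0 coef0.
  - move=> [F1 [I1 s1 <-]] [F2 [I2 s2 <-]]; exists (F1 + F2).
    split; [exact: ID| |by rewrite muniD coefD].
    rewrite muniD; apply: leq_trans (size_polyD _ _) _.
    by rewrite geq_max; apply/andP; split; [exact: s1|exact: s2].
  - move=> [F [IF sF <-]]; exists (mwiden h * F); split; first exact: IM.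
      rewrite muniM muni_mwiden mul_polyC.
      exact: leq_trans (size_scale_leq _ _) sF.
    by rewrite muniM muni_mwiden coefCM.
move=> _ [r [v le_d Dr] ->].
set e := (\sum_(i < n) _)%N in le_d.
pose F := colvdm K n.+1 (occ (ext r n v)).
pose A := [pred i : 'I_n | occ r i == mult n r v].
pose M : {poly {mpoly K[n]}} := \prod_(i | A i) ('X - ('X_i)%:P).
have monM : M \is monic by apply: monic_prod_XsubC.
have szM : size M = e.+1.
  rewrite /M -big_filter size_prod_XsubC; congr S.
  rewrite size_filter -sum1_count [LHS]big_mkcond.
  by apply: eq_bigr => i _; rewrite inE; case: eqP.
have uniF : muni F = (-1) ^+ e *: ((colvdm K n (occ r))%:P * M).
  rewrite muni_colvdmS.
  rewrite (_ : colvdm K n _ = colvdm K n (occ r)); last first.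
    by apply: eq_colvdm => i lti; apply: occ_ext.
  rewrite scalerAr; congr (_ * _).
  rewrite (eq_bigl A) => [|i]; last by rewrite occ_ext // occ_ext_last.
  rewrite (eq_bigr (fun i => (-1) * ('X - ('X_i)%:P))) => [|i _]; last first.
    by rewrite mulN1r opprB.
  rewrite big_split /= prodr_const -[RHS]mul_polyC rmorphXn rmorphN1.
  by congr (_ ^+ _ * _); rewrite -sum1_card big_mkcond.
pose N := 'X^(d - e) * M.
have monN : N \is monic by rewrite monicMl ?monicXn.
have szN : size N = d.+1.
  rewrite /N size_Mmonic ?monic_neq0 ?monicXn // szM size_polyXn.
  by rewrite addSn addnS subnK.
have uniXF :
    muni ((-1) ^+ e * 'X_ord_max ^+ (d - e) * F) = colvdm K n (occ r) *: N.
  rewrite !muniM uniF !rmorphXn /= muniN1 muni_max /N -!mul_polyC.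
  rewrite rmorphXn rmorphN1; move: (_%:P) ('X^_) (M) => u y m.
  rewrite [LHS](_ : _ = (-1) ^+ e * (-1) ^+ e * (u * (y * m))); last by ring.
  by rewrite -expr2 sqrr_sign mul1r.
exists ((-1) ^+ e * 'X_ord_max ^+ (d - e) * F); split.
- by apply/IM/mem_ideal_gen; exists (ext r n v).
- by rewrite uniXF -szN size_scale_leq.
- have := monicP monN; rewrite lead_coefE szN /= => N1.
  by rewrite uniXF coefZ N1 mulr1.
Qed.

Lemma vanish_tableau_gen_ideal n D f :
  column_closed n D -> ideal_gen (tableau_gen D) f -> @vanish n D f.
Proof.
move=> clD; apply: ideal_gen_min; first exact: vanish_ideal.
by move=> g; apply: vanish_tableau_gen.
Qed.

(** Induction on n, then on the degree d in the last variable: the leading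
    coefficient of f is that of some F in the ideal generated by D, and f - F
    vanishes off D because F does. *)
Theorem vanish_mem n : forall D f,
  column_closed n D -> @vanish n D f -> ideal_gen (tableau_gen D) f.
Proof.
elim: n => [|n IHn] D f clD.
  (* All points agree in dimension 0, and the empty product is 1. *)
  move=> /(_ (fun=> 0))[D0|].
    rewrite -[f]mulr1; have [_ _ IM] := ideal_gen_ideal (@tableau_gen 0 D).
    apply: IM; apply: mem_ideal_gen; exists (fun=> 0) => //.
    by rewrite /colvdm big_ord0.
  rewrite [f]nvar0_mpolyC [ev _ _]mmapC => /eqP; rewrite fmorph_eq0 => /eqP ->.
  by rewrite mpolyC0; have [] := ideal_gen_ideal (@tableau_gen 0 D).
have [I0 ID IM] := ideal_gen_ideal (@tableau_gen n.+1 D).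
have [m] := ubnP (size (muni f)).
elim: m f => // m IHm f; rewrite ltnS => le_m Vf.
case sz: (size (muni f)) => [|d].
  suff -> : f = 0 by [].
  by apply: muni_inj; apply/eqP; rewrite muni0 -size_poly_eq0 sz.
have Vd := vanish_coef Vf (eq_leq sz).
have [F [IF szF leadF]] :=
  lead_tableau_gen (IHn _ _ (column_closed_add_box fresh clD) Vd).
have sz_sub : (size (muni (f - F)%R) <= d)%N.
  by rewrite muniB; apply: (size_subr_lead (eq_leq sz) szF (esym leadF)).
rewrite -(subrK F f); apply: (ID _ _ _ IF).
apply: (IHm _ (leq_ltn_trans sz_sub _)); first by rewrite -sz.
have [_ VD VM] := @vanish_ideal n.+1 D.
apply: (VD _ _ Vf); rewrite -mulN1r; apply: VM.
exact: (vanish_tableau_gen_ideal clD IF).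
Qed.

End Vanishing.

(** * Balancing the columns *)

Lemma size_prod_XsubC_card (R : nzRingType) (I : finType) (A : pred I)
    (F : I -> R) :
  size (\prod_(i | A i) ('X - (F i)%:P)) = #|A|.+1.
Proof.
by rewrite -big_filter size_prod_XsubC size_filter -sum1_count sum1_card.
Qed.

Section Balancing.

Variables (n : nat) (R : idomainType) (x : 'I_n -> R).
Hypothesis x_inj : injective x.
Implicit Types (A B : {set 'I_n}) (i j k : 'I_n).

Definition vdm A : R :=
  \prod_(p in A) \prod_(q in A | (p < q)%N) (x p - x q).

(** The sign (-1) ^+ m, where m is the number of elements of A below i; it moves
    the factors x_p - x_i with p < i to the form x_i - x_p. *)
Definition rank_sign A i : R := \prod_(p in A) (-1) ^+ (p < i)%N.

Lemma rank_sign2 A i : rank_sign A i * rank_sign A i = 1.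
Proof. by rewrite -big_split big1 //= => p _; rewrite -expr2 sqrr_sign. Qed.

Lemma vdm_setU1 A i : i \notin A ->
  vdm (i |: A) = rank_sign A i * \prod_(p in A) (x i - x p) * vdm A.
Proof.
move=> iA; rewrite /vdm big_setU1 //= /rank_sign -big_split /=.
rewrite [X in X * _]big_mkcondr big_setU1 //= ltnn mul1r -!big_split /=.
apply: eq_bigr => p pA.
rewrite [X in _ * X]big_mkcondr big_setU1 //= -big_mkcondr /=.
rewrite mulrA; congr (_ * _); case: (ltngtP p i) => [_|_|/val_inj eq_pi].
- by rewrite mul1r expr1 mulN1r opprB.
- by rewrite mulr1 mul1r.
- by rewrite -eq_pi pA in iA.
Qed.

Lemma vdm_setD1 A i : i \in A ->
  vdm A = rank_sign (A :\ i) i * \prod_(p in A :\ i) (x i - x p) * vdm (A :\ i).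
Proof. by move=> iA; rewrite -{1}(setD1K iA) vdm_setU1 // !inE eqxx. Qed.

(** Lagrange interpolation of Q at the nodes x_i, i in A, with denominators
    cleared: compare the coefficients of degree #|A| - 1. *)
Lemma vdm_lagrange A (Q : {poly R}) :
  Q \is monic -> size Q = #|A| ->
  vdm A = \sum_(i in A) rank_sign (A :\ i) i * Q.[x i] * vdm (A :\ i).
Proof.
move=> monQ szQ.
pose B i : {poly R} := \prod_(p in A :\ i) ('X - (x p)%:P).
have monB i : B i \is monic by apply: monic_prod_XsubC.
have szB i : i \in A -> size (B i) = #|A|.
  by move=> iA; rewrite /B size_prod_XsubC_card [RHS](cardsD1 i) iA.
pose c i := rank_sign (A :\ i) i * Q.[x i] * vdm (A :\ i).
pose P := vdm A *: Q - \sum_(i in A) c i *: B i.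
have P0 : P = 0.
  apply: (@roots_geq_poly_eq0 _ _ [seq x i | i <- enum A]).
  - apply/allP => _ /mapP[i + ->]; rewrite mem_enum => iA.
    rewrite rootE /P hornerD hornerN hornerZ horner_sum (bigD1 i) //= big1.
      rewrite addr0 hornerZ /B horner_prod.
      under [X in _ * _ - _ * X]eq_bigr do rewrite hornerXsubC.
      by rewrite (vdm_setD1 iA) /c subr_eq0; apply/eqP; ring.
    move=> j /andP[jA ji]; rewrite hornerZ /B horner_prod (bigD1 i) /=.
      by rewrite hornerXsubC subrr mul0r mulr0.
    by rewrite !inE eq_sym ji.
  - by rewrite (map_inj_uniq x_inj) enum_uniq.
  - rewrite size_map -cardE (leq_trans (size_polyD _ _)) // geq_max.
    rewrite -{1}szQ size_scale_leq size_opp.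
    apply: (big_ind (fun p : {poly _} => size p <= #|A|)%N).
    + by rewrite size_poly0.
    + by move=> p q sp sq; rewrite (leq_trans (size_polyD _ _)) // geq_max sp.
    + by move=> i iA; rewrite -(szB i iA) size_scale_leq.
have := congr1 (fun p : {poly _} => p`_#|A|.-1) P0.
rewrite coef0 coefB coefZ -{1}szQ -lead_coefE (monicP monQ) mulr1.
move/eqP; rewrite subr_eq0 => /eqP ->; rewrite coef_sum; apply: eq_bigr => i iA.
by rewrite coefZ -(szB i iA) -lead_coefE (monicP (monB i)) mulr1.
Qed.

(** In [vdm_lagrange] take for Q a power of X times the product of the X - x_b,
    b in B: the value of Q at x_i supplies the factors that turn the Vandermonde
    product of B into the one of i |: B. *)
Lemma vdm_exchange (I : R -> Prop) A B h : is_ideal I ->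
  [disjoint A & B] -> (#|B| < #|A|)%N ->
  (forall i, i \in A -> I (vdm (A :\ i) * vdm (i |: B) * h)) ->
  I (vdm A * vdm B * h).
Proof.
move=> idI disAB ltBA IAB; have [_ _ IM] := idI.
pose Q : {poly R} :=
  'X^(#|A|.-1 - #|B|) * \prod_(b in B) ('X - (x b)%:P).
have monP : \prod_(b in B) ('X - (x b)%:P : {poly R}) \is monic.
  exact: monic_prod_XsubC.
have monQ : Q \is monic by rewrite monicMl ?monicXn.
have szQ : size Q = #|A|.
  rewrite /Q size_Mmonic ?monic_neq0 ?monicXn // size_polyXn.
  have -> : size (\prod_(b in B) ('X - (x b)%:P)) = #|B|.+1.
    exact: size_prod_XsubC_card.
  by lia.
rewrite (vdm_lagrange monQ szQ) !mulr_suml; apply: is_ideal_sum => // i iA.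
have iB : i \notin B by rewrite (disjointFr disAB iA).
pose u := rank_sign (A :\ i) i * rank_sign B i * x i ^+ (#|A|.-1 - #|B|).
have := IM u _ (IAB i iA); rewrite /u.
congr (I _); rewrite (vdm_setU1 iB) /Q hornerM hornerXn horner_prod.
under [in RHS]eq_bigr do rewrite hornerXsubC.
transitivity (rank_sign B i * rank_sign B i * (rank_sign (A :\ i) i *
  (x i ^+ (#|A|.-1 - #|B|) * \prod_(b in B) (x i - x b)) *
  vdm (A :\ i) * vdm B * h)).
  by ring.
by rewrite rank_sign2 mul1r.
Qed.

Variable a : nat.
Implicit Types c : {ffun 'I_n -> 'I_a}.

Definition fiber c (k : 'I_a) : {set 'I_n} := [set p | c p == k].

Definition colprod c : R := \prod_k vdm (fiber c k).

Definition balanced c :=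
  [forall k, forall l, (#|fiber c k| <= #|fiber c l|.+1)%N].

(** Moving an element from a fiber to one smaller by at least two decreases the
    sum of the squares of the sizes of the fibers. *)
Lemma colprod_balance (I : R -> Prop) : is_ideal I ->
  (forall c, balanced c -> I (colprod c)) -> forall c, I (colprod c).
Proof.
move=> idI Ibal c.
have [m] := ubnP (\sum_k #|fiber c k| ^ 2)%N; elim: m c => // m IHm c.
rewrite ltnS => le_m.
have [/Ibal//|/forallPn[k /forallPn[l]]] := boolP (balanced c).
rewrite -ltnNge => lt_lk.
have lk : l != k by apply: contraTneq lt_lk => ->; rewrite ltnNge leqnSn.
have split_prod d : colprod d = vdm (fiber d k) * vdm (fiber d l) *
    \prod_(j | (j != k) && (j != l)) vdm (fiber d j).
  by rewrite /colprod (bigD1 k) // (bigD1 l) //= mulrA.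
have split_sum d : (\sum_j #|fiber d j| ^ 2 =
    #|fiber d k| ^ 2 + #|fiber d l| ^ 2 +
    \sum_(j | (j != k) && (j != l)) #|fiber d j| ^ 2)%N.
  by rewrite (bigD1 k) // (bigD1 l) //= addnA.
rewrite split_prod; apply: vdm_exchange (idI) _ (ltnW lt_lk) _.
  apply/pred0P => p; rewrite !inE; apply: contraNF lk => /andP[/eqP <- /eqP <-].
  exact: eqxx.
move=> i; rewrite inE => /eqP cik.
pose d : {ffun 'I_n -> 'I_a} := [ffun p => if p == i then l else c p].
have dk : fiber d k = fiber c k :\ i.
  apply/setP => p; rewrite !inE ffunE.
  by case: (eqVneq p i) => //= _; apply: negbTE lk.
have dl : fiber d l = i |: fiber c l.
  apply/setP => p; rewrite !inE ffunE.
  by case: (eqVneq p i) => //= _; rewrite eqxx.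
have dj (j : 'I_a) : (j != k) && (j != l) -> fiber d j = fiber c j.
  case/andP=> jk jl; apply/setP => p; rewrite !inE ffunE.
  case: (eqVneq p i) => //= ->.
  by rewrite cik ![_ == j]eq_sym (negbTE jk) (negbTE jl).
have := split_prod d; rewrite dk dl.
under [in RHS]eq_bigr do rewrite dj //.
move=> <-; apply: IHm; apply: leq_trans le_m; rewrite !split_sum dk dl.
under [in X in (X < _)%N]eq_bigr do rewrite dj //.
rewrite ltn_add2r cardsU1 inE cik eq_sym lk.
rewrite (cardsD1 i (fiber c k)) inE cik eqxx.
move: lt_lk; rewrite (cardsD1 i (fiber c k)) inE cik eqxx.
by move: #|_| #|_| => u v; nia.
Qed.

End Balancing.

(** * The shape (a, a, 1) *)

Section Shape_aa1.

Variables (a n : nat).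
Hypotheses (a_gt0 : (1 <= a)%N) (def_n : n = (2 * a + 1)%N).

Lemma pigeonhole (L : eqType) (p : nat -> L) v (g : 'I_n -> nat) :
  (forall q, (g q < a)%N) -> (a < mult n p v)%N ->
  exists q1 q2 : 'I_n, [/\ (q1 < q2)%N, g q1 = g q2 & p q1 = p q2].
Proof.
move=> g_lt gt_a; pose S := [set q : 'I_n | p q == v].
have cardS : mult n p v = #|S|.
  rewrite -sum1_card [RHS]big_mkcond; apply: eq_bigr => q _.
  by rewrite inE; case: eqP.
have [/dinjectiveP inj_g|] := boolP (dinjectiveb g (mem S)).
  suff : (#|S| <= a)%N by rewrite leqNgt -cardS gt_a.
  rewrite cardE -(size_map g) -[a in (_ <= a)%N](size_iota 0).
  apply: uniq_leq_size => [|_ /mapP[q _ ->]]; last by rewrite mem_iota g_lt.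
  rewrite map_inj_in_uniq ?enum_uniq // => q q'.
  by rewrite !mem_enum; apply: inj_g.
case/dinjectivePn => q + [q' + eqg]; rewrite !inE.
move=> /eqP qv /andP[neq /eqP q'v].
case: (ltngtP q q') => [lt|lt|/val_inj eq_q]; last by rewrite eq_q eqxx in neq.
  by exists q, q'; rewrite qv q'v.
by exists q', q; rewrite qv q'v.
Qed.

(** A word all of whose letters occur at most a times has at most a columns, and
    a point has each value at most once in each column. *)
Lemma column_closed_mult_le (L : eqType) :
  column_closed n
    (fun p : nat -> L => [forall i : 'I_n, mult n p (p i) <= a]%N).
Proof.
move=> r p /forallP r_le inj_p; apply/forallP => i; rewrite leqNgt.
apply/negP => /(pigeonhole (g := fun q => occ r q))[|q1 [q2 [lt12 eqo eqp]]].
  by move=> q; apply: leq_trans (occ_lt_mult r (ltn_ord q)) (r_le q).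
by have := inj_p q1 q2; rewrite lt12 ltn_ord eqp eqxx => /(_ isT eqo).
Qed.

Definition shape_aa1 := [:: a; a; 1%N].

Lemma col_lt (b : box shape_aa1) : (col_of b < a)%N.
Proof.
case: b => [[i lti] [j ltj]]; rewrite /col_of /=.
by case: i lti ltj => [|[|[|]]] //= _; rewrite ltnS leqn0 => /eqP ->.
Qed.

Lemma box_eq (b b' : box shape_aa1) :
  row_of b = row_of b' -> col_of b = col_of b' -> b = b'.
Proof.
case: b b' => [i j] [i' j']; rewrite /row_of /col_of /= => /val_inj eqi.
by case: _ / eqi j' => j' /val_inj ->.
Qed.

(** A value occurring more than a times is repeated in one of the a columns. *)
Lemma ev_specht_poly (K : fieldType) (L : idomainType)
    (phi : {rmorphism K -> L}) (p : nat -> L) v (T : tableau shape_aa1 n) :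
  (a < mult n p v)%N -> ev phi p (specht_poly K T) = 0.
Proof.
move=> gt_a.
have [q1 [q2 [lt12 eqc eqp]]] :=
  pigeonhole (fun q => col_lt (T q)) gt_a.
have neq : q1 != q2 by rewrite -(inj_eq val_inj) neq_ltn lt12.
wlog lt_row : q1 q2 {lt12} neq eqc eqp / (row_of (T q1) < row_of (T q2))%N.
  move=> wlog_row.
  case: (ltngtP (row_of (T q1)) (row_of (T q2))) => [lt|gt|eqr].
  - exact: wlog_row neq eqc eqp lt.
  - by apply: (wlog_row q2 q1); rewrite // eq_sym.
  - by have := bij_inj (entry_box_bij T) (box_eq eqr eqc); move/eqP: neq.
rewrite /specht_poly big_mkord (bigD1 (Ordinal (col_lt (T q1)))) //=.
rewrite /specht_col (bigD1 q1) //= (bigD1 q2) /= ?eqc ?eqxx //.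
by rewrite !rmorphM rmorphB /= !evX eqp subrr !mul0r.
Qed.

(** The sizes sum to 2 a + 1 and differ by at most one: one of them exceeds 2, so
    all are at least 2, and their total excess over 2 is 1. *)
Lemma balanced_fibers (c : {ffun 'I_n -> 'I_a}) : balanced c ->
  exists k0, forall k, #|fiber c k| = (2 + (k == k0))%N.
Proof.
move=> /forallP bal.
have sum_f : (\sum_k #|fiber c k| = 2 * a + 1)%N.
  rewrite -def_n -[n in RHS]card_ord -sum1_card (partition_big c xpredT) //=.
  apply: eq_bigr => k _; rewrite -sum1_card.
  by apply: eq_bigl => p; rewrite inE.
have [/existsP[k0 gt2]|/existsPn le2] :=
  boolP [exists k, 2 < #|fiber c k|]%N; last first.
  have : (\sum_k #|fiber c k| <= \sum_(k < a) 2)%N.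
    by apply: leq_sum => k _; rewrite leqNgt.
  by rewrite sum_f sum_nat_const card_ord; lia.
have ge2 k : (2 <= #|fiber c k|)%N.
  by have /forallP/(_ k) := bal k0; move: gt2; lia.
have sum_e : (\sum_k (#|fiber c k| - 2) = 1)%N.
  have : (\sum_k #|fiber c k| = \sum_k (#|fiber c k| - 2) + \sum_(k < a) 2)%N.
    by rewrite -big_split; apply: eq_bigr => k _; rewrite /= subnK.
  by rewrite sum_f sum_nat_const card_ord; lia.
move: sum_e; rewrite (bigD1 k0) //= => sum_e.
have e0 : (\sum_(k | k != k0) (#|fiber c k| - 2) = 0)%N.
  by move: gt2 sum_e; move: #|_| (\sum_(k | _) _)%N => u w; lia.
exists k0 => k; have [->|kk0] := eqVneq k k0.
  by move: gt2 sum_e; rewrite e0 addn0; move: #|_| => u; lia.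
move/eqP: e0; rewrite sum_nat_eq0 => /forallP/(_ k); rewrite kk0 /=.
by rewrite subn_eq0 addn0 => le2; apply/eqP; rewrite eqn_leq le2 ge2.
Qed.

Section Filling.

Variables (c : {ffun 'I_n -> 'I_a}) (k0 : 'I_a).
Hypothesis k0_0 : k0 = 0%N :> nat.
Hypothesis card_fiber : forall k, #|fiber c k| = (2 + (k == k0))%N.

Definition entries_above (p : 'I_n) : {set 'I_n} :=
  [set q in fiber c (c p) | (q < p)%N].

Lemma entries_above_lt p q : c p = c q ->
  (p < q)%N = (#|entries_above p| < #|entries_above q|)%N.
Proof.
have lt_card p1 q1 : c p1 = c q1 ->
    (p1 < q1)%N -> (#|entries_above p1| < #|entries_above q1|)%N.
  move=> eqc lt_pq; apply/proper_card/properP; split.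
    by apply/subsetP => i; rewrite !inE eqc => /andP[-> /ltn_trans ->].
  by exists p1; rewrite !inE ?eqc ?eqxx ?ltnn ?lt_pq.
move=> eqc; case: (ltngtP p q) => [lt|gt|/val_inj ->]; last by rewrite ltnn.
  by rewrite lt_card.
by apply/esym/negbTE; rewrite -leqNgt ltnW // lt_card.
Qed.

Lemma entries_above_lt_fiber p : (#|entries_above p| < #|fiber c (c p)|)%N.
Proof.
apply/proper_card/properP; split.
  by apply/subsetP => i; rewrite !inE => /andP[].
by exists p; rewrite !inE ?eqxx ?ltnn.
Qed.

Lemma entries_above_lt3 p : (#|entries_above p| < size shape_aa1)%N.
Proof.
apply: leq_trans (entries_above_lt_fiber p) _; rewrite card_fiber.
by case: (_ == _).
Qed.

Lemma column_in_row p : (c p < nth 0%N shape_aa1 #|entries_above p|)%N.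
Proof.
have := entries_above_lt_fiber p; rewrite card_fiber.
case: #|entries_above p| => [|[|[|m]]] /=.
- by rewrite ltn_ord.
- by rewrite ltn_ord.
- by have [->|//] := eqVneq (c p) k0; rewrite k0_0.
- by case: (c p == k0).
Qed.

Definition filling (p : 'I_n) : box shape_aa1 :=
  existT (fun i : 'I_(size shape_aa1) => 'I_(nth 0%N shape_aa1 i))
    (Ordinal (entries_above_lt3 p)) (Ordinal (column_in_row p)).

Lemma filling_bij : bijective filling.
Proof.
apply: inj_card_bij => [p q eq_pq|].
  have eqr := congr1 (@row_of shape_aa1) eq_pq.
  have eqc := congr1 (@col_of shape_aa1) eq_pq.
  rewrite /row_of /col_of /= in eqr eqc; have {}eqc := val_inj eqc.
  have := entries_above_lt eqc; have := entries_above_lt (esym eqc).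
  by rewrite eqr ltnn; case: (ltngtP p q) => // /val_inj.
have card_row (i : 'I_(size shape_aa1)) := card_ord (nth 0%N shape_aa1 i).
rewrite card_ord card_tagged (eq_map card_row).
rewrite (map_comp (nth 0%N shape_aa1) val) val_enum_ord /= def_n addn0 addnA.
by rewrite addnn -mul2n.
Qed.

(** Filling each column in increasing order makes the row order within a column
    agree with the order of the indices, so the Specht polynomial is the column
    product without any sign. *)
Lemma specht_filling (K : fieldType) :
  specht_poly K (Tableau filling_bij) =
  colprod (fun p => 'X_p : {mpoly K[n]}) c.
Proof.
rewrite /specht_poly big_mkord; apply: eq_bigr => k _.
rewrite /specht_col /vdm; apply: eq_big => [p|p]; rewrite ?inE //.
rewrite /col_of /= => /eqP /val_inj cp; apply: eq_bigl => q.
rewrite inE /row_of /col_of /= -(inj_eq val_inj).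
by apply: andb_id2l => /eqP/val_inj cq; rewrite entries_above_lt // cp cq.
Qed.

End Filling.

(** The transposition of two colors brings the fiber of size 3 to the first
    column, the only one with a box in the third row. *)
Lemma balanced_specht (K : fieldType) (c : {ffun 'I_n -> 'I_a}) : balanced c ->
  specht_ideal K n shape_aa1 (colprod (fun p => 'X_p : {mpoly K[n]}) c).
Proof.
move=> /balanced_fibers[k1 card_f]; pose k0 := Ordinal a_gt0.
pose s := tperm k0 k1.
pose d := [ffun p => s (c p)].
have fib k : fiber d k = fiber c (s k).
  by apply/setP => p; rewrite !inE ffunE -(inj_eq (@perm_inj _ s)) tpermK.
have card_d k : #|fiber d k| = (2 + (k == k0))%N.
  by rewrite fib card_f -(inj_eq (@perm_inj _ s)) tpermK tpermR.
have -> : colprod (fun p => 'X_p : {mpoly K[n]}) c =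
    colprod (fun p => 'X_p : {mpoly K[n]}) d.
  rewrite /colprod (reindex_inj (@perm_inj _ s)).
  by apply: eq_bigr => k _; rewrite fib.
rewrite -(@specht_filling d k0 erefl card_d); apply: mem_ideal_gen.
by exists (Tableau (@filling_bij d k0 erefl card_d)).
Qed.

Lemma colvdm_colprod (K : fieldType) (e : nat -> nat)
    (c : {ffun 'I_n -> 'I_a}) :
  (forall p : 'I_n, e p = c p) ->
  colvdm K n e = colprod (fun p => 'X_p : {mpoly K[n]}) c.
Proof.
move=> eq_ec; rewrite /colvdm (partition_big c xpredT) //=.
apply: eq_bigr => k _; apply: eq_big => [p|p /eqP cp]; rewrite ?inE //.
apply: eq_bigl => q; rewrite inE !eq_ec (inj_eq val_inj) cp.
by rewrite eq_sym.
Qed.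

Lemma specht_radical (K : fieldType) :
  is_radical_ideal (specht_ideal K n shape_aa1).
Proof.
split=> [|f k fk]; first exact: ideal_gen_ideal.
pose D (p : nat -> {poly K}) := [forall i : 'I_n, mult n p (p i) <= a]%N.
have fresh (s : seq {poly K}) : exists v, v \notin s.
  exists 'X^(\max_(v <- s) size v); apply/negP => vs.
  have := @leq_bigmax_seq {poly K} s xpredT (fun v => size v) _ vs isT.
  by rewrite size_polyXn ltnn.
have Vf : vanish polyC D f.
  move=> p; have [|/forallPn[i]] := boolP (D p); first by left.
  rewrite -ltnNge => gt_a.
  right; suff /eqP : ev polyC p (f ^+ k) = 0.
    by rewrite rmorphXn expf_eq0 => /andP[_ /eqP].
  move: fk; apply: (ideal_gen_min (ev_eq0_ideal polyC n p)) => _ [T ->].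
  exact: ev_specht_poly gt_a.
have := vanish_mem fresh (@column_closed_mult_le _) Vf.
apply: ideal_gen_min; first exact: ideal_gen_ideal.
move=> _ [r /forallP r_le ->].
have occ_lt (p : 'I_n) : (occ r p < a)%N.
  exact: leq_trans (occ_lt_mult r (ltn_ord p)) (r_le p).
rewrite (@colvdm_colprod K _ [ffun p => Ordinal (occ_lt p)]) => [|p]; last first.
  by rewrite ffunE.
apply: colprod_balance => [p q eqX||d].
- have /eqP := congr1 (mcoeff U_(p)) eqX.
  by rewrite !mcoeffXU eqxx; case: (eqVneq q p) => // _; rewrite oner_eq0.
- exact: ideal_gen_ideal.
- exact: balanced_specht.
Qed.

End Shape_aa1.

Theorem theorem4p2 (K : fieldType) (a n : nat) (ha : (1 <= a)%N)
    (hn : n = (2 * a + 1)%N) :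
  is_radical_ideal (specht_ideal K n [:: a; a; 1%N]).
Proof. exact: specht_radical ha hn K. Qed.
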